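(* Let $G$ be a countably infinite group. For every continuous action $G \curvearrowright X$ on a Polish space $X$, there is a $G$-invariant Polish subspace $Y \subseteq 4^G$ such that $G \curvearrowright Y$ continuously factors onto $G \curvearrowright X$.
   Context: $4^G$ denotes the set of functions $x : G \to \{1,2,3,4\}$ with the product topology and the left shift action $(g\cdot x)(h) = x(g^{-1}h)$ of $G$. A topological space is Polish if it contains a countable dense subset and admits a compatible complete metric. A subset $Y$ of a Polish space is a Polish subspace if the subspace topology on $Y$ is Polish (equivalently, $Y$ is a $G_\delta$ subset). $G \curvearrowright Y$ continuously factors onto $G \curvearrowright X$ if there is a continuous $G$-equivariant surjection $Y \to X$. *)

(* Defs.v *)
From HB Require Import structures.
From mathcomp Require Import all_boot all_order all_algebra.
From mathcomp Require Import all_classical all_reals all_analysis.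

Set Implicit Arguments.
Unset Strict Implicit.
Unset Printing Implicit Defensive.

Import Order.TTheory GRing.Theory Num.Theory.

Local Open Scope classical_set_scope.
Local Open Scope ring_scope.

Section Polish.
Context {R : realType} {T : topologicalType}.
Implicit Type d : T -> T -> R.

Definition is_metric d : Prop :=
  [/\ forall x y, 0 <= d x y,
      forall x y, d x y = 0 <-> x = y,
      forall x y, d x y = d y x &
      forall x y z, d x z <= d x y + d y z].

Definition compatible_metric d : Prop :=
  forall (x : T) (A : set T),
    nbhs x A <-> exists2 e : R, 0 < e & [set y | d x y < e] `<=` A.

Definition cauchy_seq d (u : nat -> T) : Prop :=
  forall e : R, 0 < e ->
    exists N : nat, forall m n : nat, (N <= m)%N -> (N <= n)%N ->
      d (u m) (u n) < e.

(* Convergence is in the topology of T, which is that of d when d is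
   compatible. *)
Definition complete_metric d : Prop :=
  forall u : nat -> T, cauchy_seq d u -> exists x : T, u @ \oo --> x.

End Polish.

(* The empty space is Polish. *)
Definition polish (R : realType) (T : topologicalType) : Prop :=
  (exists2 D : set T, countable D & dense D) /\
  (exists d : T -> T -> R,
     [/\ is_metric d, compatible_metric d & complete_metric d]).

(* G is given the discrete topology. *)
Definition continuous_action (G : groupType) (X : topologicalType)
    (act : G -> X -> X) : Prop :=
  [/\ forall x, act 1%g x = x,
      forall g h x, act (g * h)%g x = act g (act h x) &
      continuous (fun p : discrete_topology G * X => act p.1 p.2)].

(* 4^G; the alphabet is 'I_4, i.e. {0,1,2,3}, rather than {1,2,3,4}. *)
Definition full_shift (G : groupType) : topologicalType :=
  {ptws G -> discrete_topology 'I_4}.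

Definition left_shift (G : groupType) (g : G) (x : full_shift G) : full_shift G :=
  fun h : G => x (g^-1 * h)%g.

Definition shift_invariant (G : groupType) (Y : set (full_shift G)) : Prop :=
  forall (g : G) (x : full_shift G), Y x -> Y (left_shift g x).

(* As a type, a set Y carries the subspace topology. *)
Definition restricted_shift (G : groupType) (Y : set (full_shift G))
    (invY : shift_invariant Y) (g : G) (y : Y) : Y :=
  SigSub (mem_set (invY g (val y) (set_mem (valP y)))).

Definition continuously_factors_onto (G : groupType) (Y X : topologicalType)
    (actY : G -> Y -> Y) (actX : G -> X -> X) : Prop :=
  exists f : Y -> X,
    [/\ continuous f,
        forall g y, f (actY g y) = actX g (f y) &
        forall x, exists y, f y = x].

(* Main.v *)
Require Import Defs.
From mathcomp Require Import all_boot all_order all_algebra.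
From mathcomp Require Import all_classical all_reals all_analysis.

Set Implicit Arguments.
Unset Strict Implicit.
Unset Printing Implicit Defensive.

Import Order.TTheory GRing.Theory Num.Theory.

Local Open Scope classical_set_scope.
Local Open Scope ring_scope.

(** The idea is to mark one element of the group in every point of Y, so that a
    point of Y carries its own origin and the shift acts freely, by moving the
    origin. An alphabet of four letters is an alphabet of pairs of bits. The
    first bit of a point of Y is 1 at exactly one element o of G, its origin.
    The second bit, read relative to o through a bijection between G and the
    natural numbers, is the indicator function of the graph of a sequence
    s : nat -> nat. Such a point is [marked o s], and a left shift by g turns it
    into [marked (g * o) s] ([left_shift_marked]).

    A Polish space X is a continuous image of a closed set of sequences of
    naturals: let s name x when s n is the index, in a countable dense set, of a
    point at distance at most 1 / (n + 1) from x ([polish_names]). Let Y consist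
    of the points [marked o s] in which s names some x, and send such a point to
    o x. This map is equivariant since the shift only multiplies o on the left,
    and it is onto already on the points with origin 1.

    Since reading the origin and each value of s takes finitely many coordinates,
    and conversely each coordinate depends on o and at most one value of s, the
    subspace topology of Y is that of G times the closed set of names
    ([nbhs_marked]). This gives continuity of the map, and it makes Y
    homeomorphic to a closed subset of the Baire space, hence Polish
    ([polish_of_code]). *)

Lemma invS_lt (R : realType) (e : R) : 0 < e -> exists N : nat, N.+1%:R^-1 < e.
Proof.
move=> e0; have [N _ NP] := near_infty_natSinv_lt (PosNum e0).
by exists N; exact: (NP N (leqnn N)).
Qed.

Lemma ler_invS (R : realType) (m n : nat) :
  (m <= n)%N -> n.+1%:R^-1 <= m.+1%:R^-1 :> R.
Proof. by move=> mn; rewrite lef_pV2 ?posrE ?ltr0Sn // ler_nat ltnS. Qed.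

(** * Closed subsets of the Baire space are Polish *)

Definition agree (N : nat) (s t : nat -> nat) : Prop :=
  forall n, (n < N)%N -> s n = t n.

Lemma near_agree (T : topologicalType) (y : T) (c : T -> nat -> nat) (w : nat -> nat) N :
  (forall n, \forall z \near y, w n = c z n) -> \forall z \near y, agree N w (c z).
Proof.
move=> H; elim: N => [|N IH]; first by apply: nearW => z n.
near=> z; move=> n; rewrite ltnS leq_eqVlt => /predU1P[->|].
  by near: z; exact: H.
by move: n; near: z; exact: IH.
Unshelve. all: by end_near. Qed.

Section code_dist.
Variables (R : realType) (T : topologicalType) (c : T -> nat -> nat).

(** The standard ultrametric on sequences, 1 / (m + 1) where m is the first index
    at which the codes of x and y differ. *)
Definition code_dist (x y : T) : R :=
  if pselect (exists n, c x n != c y n) is left ne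
  then (ex_minn ne).+1%:R^-1 else 0.

Lemma code_dist_ge0 x y : 0 <= code_dist x y.
Proof. by rewrite /code_dist; case: pselect => // ?; rewrite invr_ge0. Qed.

Lemma code_dist_ge x y m : c x m != c y m -> m.+1%:R^-1 <= code_dist x y.
Proof.
move=> ne; rewrite /code_dist; case: pselect => [ex|[]]; last by exists m.
by case: ex_minnP => k _ /(_ _ ne) km; exact: ler_invS.
Qed.

Lemma code_dist_le N x y : agree N (c x) (c y) -> code_dist x y <= N.+1%:R^-1.
Proof.
move=> xy; rewrite /code_dist; case: pselect => [ex|_]; last by rewrite invr_ge0.
case: ex_minnP => k kne _; apply: ler_invS; rewrite leqNgt; apply/negP => kN.
by move: kne; rewrite (xy _ kN) eqxx.
Qed.

Lemma agree_code_dist N x y : code_dist x y < N.+1%:R^-1 -> agree N.+1 (c x) (c y).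
Proof.
move=> xy n nN; apply: contraTeq xy => /code_dist_ge ne.
by rewrite -leNgt (le_trans _ ne)// ler_invS.
Qed.

(** For the triangle inequality: at the first index where x and z differ, y
    differs from one of them, so one of the two summands already dominates. *)
Lemma code_dist_metric :
  (forall x y, c x =1 c y -> x = y) -> is_metric code_dist.
Proof.
move=> c_inj; split.
- exact: code_dist_ge0.
- move=> x y; split=> [xy0|->].
    apply: c_inj => n; apply/eqP; apply: contraPT xy0 => /code_dist_ge ne e0.
    by move: ne; rewrite e0 leNgt invr_gt0 ltr0Sn.
  by rewrite /code_dist; case: pselect => // ex; have [n] := ex; rewrite eqxx.
- move=> x y; apply/eqP; rewrite eq_le; apply/andP.
  suff H u v : code_dist u v <= code_dist v u by split; exact: H.
  rewrite {1}/code_dist; case: pselect => [ex|_]; last exact: code_dist_ge0.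
  by case: ex_minnP => k + _; rewrite eq_sym => /code_dist_ge.
- move=> x y z; rewrite {1}/code_dist; case: pselect => [ex|_]; last first.
    by rewrite addr_ge0 ?code_dist_ge0.
  case: ex_minnP => k kne _.
  have [xy|xy] := eqVneq (c x k) (c y k).
    rewrite -[leLHS]add0r lerD ?code_dist_ge0//.
    by apply: code_dist_ge; rewrite -xy.
  by rewrite -[leLHS]addr0 lerD ?code_dist_ge0// code_dist_ge.
Qed.

(** The hypotheses say that c is a homeomorphism of T onto a closed subset of the
    Baire space. Choosing, for every finite sequence that is a prefix of some
    code, one point whose code extends it gives a countable dense set. A Cauchy
    sequence for [code_dist] has codes that stabilize at each index, and
    closedness makes the sequence of stable values a code. *)
Lemma polish_of_code :
    (forall x y, c x =1 c y -> x = y) ->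
    (forall x A, nbhs x A <-> exists N, [set y | agree N (c x) (c y)] `<=` A) ->
    (forall w, (forall N, exists x, agree N w (c x)) -> exists x, w =1 c x) ->
  polish R T.
Proof.
move=> c_inj c_nbhs c_closed; split.
  have /choice[F FP] (p : seq nat) : exists A : set T,
      is_subset1 A /\ forall x, agree (size p) (nth 0%N p) (c x) ->
        exists2 y, A y & agree (size p) (nth 0%N p) (c y).
    have [[x px]|npx] := pselect (exists x, agree (size p) (nth 0%N p) (c x)).
      by exists [set x]; split=> [? ? -> ->|_ _] //; exists x.
    by exists set0; split=> // x px; case: npx; exists x.
  exists (\bigcup_p F p).
    apply: bigcup_countable => // p _; apply: finite_set_countable.
    have [Fp1 _] := FP p.
    have [[x Fpx]|nFp] := pselect (exists x, F p x).
      by apply: (@sub_finite_set _ _ [set x]) => // y /(Fp1 _ _ Fpx) ->.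
    by apply: (@sub_finite_set _ _ set0) => // y Fpy; case: nFp; exists y.
  move=> O [x Ox] oO.
  have /c_nbhs[N NO] : nbhs x O by exact: open_nbhs_nbhs.
  have [_ /(_ x)] := FP (mkseq (c x) N).
  rewrite size_mkseq; case=> [n nN|y Fy yP]; first by rewrite nth_mkseq.
  exists y; split; last by exists (mkseq (c x) N).
  by apply: NO => n nN; rewrite -yP // nth_mkseq.
exists code_dist; split; first exact: code_dist_metric.
  move=> x A; rewrite c_nbhs; split=> [[N NA]|[e e0 eA]].
    exists N.+1%:R^-1; first by rewrite invr_gt0 ltr0Sn.
    by move=> y /= /agree_code_dist xy; apply: NA => n nN; rewrite xy // ltnW.
  have [N Ne] := invS_lt e0.
  exists N => y /= /code_dist_le xy; apply: eA; exact: le_lt_trans xy Ne.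
move=> u u_cauchy.
have /choice[M MP] (N : nat) : exists M, forall m n,
    (M <= m)%N -> (M <= n)%N -> agree N.+1 (c (u m)) (c (u n)).
  have [|M MP] := u_cauchy N.+1%:R^-1; first by rewrite invr_gt0 ltr0Sn.
  by exists M => m n Mm Mn; apply: agree_code_dist; exact: MP.
have [N|x wx] := c_closed (fun n => c (u (M n)) n).
  exists (u (\max_(i < N) M i)) => n nN.
  apply: (MP n) => //; exact: (leq_bigmax (Ordinal nN)).
exists x => A /c_nbhs[N NA].
exists (\max_(i < N) M i)%N => // m /= Mm; apply: NA => n nN.
rewrite -wx; apply: (MP n) => //; apply: leq_trans Mm.
exact: (leq_bigmax (Ordinal nN)).
Qed.

End code_dist.

(** * Naming the points of a Polish space by sequences *)

(** This presents X as the image of a continuous map from a closed subset of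
    the Baire space. The presentation is a relation rather than a function so
    that the empty space is included. The bound 1 / (n + 1) at stage n makes
    any two points that have names with a common n-th term 2 / (n + 1)-close,
    from which single-valuedness and continuity follow. If every prefix of w
    starts a name of some point, these points form a Cauchy sequence, and w
    names its limit. *)
Lemma polish_names (R : realType) (X : topologicalType) : polish R X ->
  exists names : (nat -> nat) -> X -> Prop,
  [/\ forall x, exists s, names s x,
      forall s x y, names s x -> names s y -> x = y,
      forall s x A, names s x -> nbhs x A ->
        exists N, forall t y, names t y -> agree N s t -> A y &
      forall w, (forall N, exists s x, names s x /\ agree N w s) ->
        exists x, names w x].
Proof.
move=> [[D /countable_injP[j j_inj] dD] [d [[d0 dE dC dT] d_nbhs d_complete]]].
pose names (s : nat -> nat) x := forall n : nat,
  exists y, [/\ D y, j y = s n & d y x <= n.+1%:R^-1].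
(* The index of a point of D determines it, so two names with the same n-th
   term refer to the same approximating point z. *)
have common s t x y n : names s x -> names t y -> s n = t n ->
    exists z, [/\ D z, j z = s n, d z x <= n.+1%:R^-1 & d z y <= n.+1%:R^-1].
  move=> /(_ n)[z [Dz jz zx]] /(_ n)[z' [Dz' jz' zy]] st.
  have zz' : z = z' by apply: j_inj; rewrite ?inE // jz jz'.
  by exists z; split; rewrite // zz'.
have close s t x y n : names s x -> names t y -> s n = t n ->
    d x y <= n.+1%:R^-1 *+ 2.
  move=> sx ty /(common _ _ _ _ _ sx ty)[z [_ _ zx zy]].
  by rewrite mulr2n (le_trans (dT x z y))// lerD // dC.
have small (e : R) : 0 < e -> exists N : nat, N.+1%:R^-1 *+ 2 < e.
  move=> e0; have [|N Ne] := @invS_lt R (e / 2); first by rewrite divr_gt0.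
  by exists N; rewrite -[_ *+ 2]mulr_natr -ltr_pdivlMr.
exists names; split.
- move=> x.
  have /choice[y yP] (n : nat) : exists y, D y /\ d y x <= n.+1%:R^-1.
    have xB : nbhs x [set y | d x y < n.+1%:R^-1].
      by apply/d_nbhs; exists n.+1%:R^-1 => //; rewrite invr_gt0 ltr0Sn.
    have [||y [/interior_subset xy Dy]] := dD (interior [set y | d x y < n.+1%:R^-1]).
    + by exists x.
    + exact: open_interior.
    by exists y; split=> //; rewrite dC ltW.
  by exists (j \o y) => n; have [Dy yx] := yP n; exists (y n).
- move=> s x y sx sy; apply/dE/eqP; rewrite eq_le d0 andbT leNgt; apply/negP.
  by move=> /small[N]; rewrite ltNge (close s s).
- move=> s x A sx /d_nbhs[e e0 eA]; have [N Ne] := small _ e0.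
  exists N.+1 => t y ty st; apply: eA => /=; apply: le_lt_trans Ne.
  by apply: (close s t) => //; exact: st.
- move=> w /choice[s /choice[u su]].
  have u_names n : names (s n.+1) (u n.+1) by have [] := su n.+1.
  have u_w n m : (n <= m)%N -> w n = s m.+1 n by move=> nm; have [_ ->] := su m.+1.
  have [|x ux] := d_complete (fun n => u n.+1).
    move=> e /small[N Ne]; exists N => m n Nm Nn; apply: le_lt_trans Ne.
    by apply: (close (s m.+1) (s n.+1)) => //; rewrite -!u_w.
  (* The n-th approximation y of u n.+1 is also that of u m.+1 for all m >= n,
     and the distance bound from y passes to the limit. *)
  exists x => n; have [y [Dy jy yu]] := u_names n n.
  exists y; split=> //; first by rewrite jy -u_w.
  apply/ler_addgt0Pr => e e0.
  have [N _ NP] : \forall m \near \oo, d x (u m.+1) < e.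
    by apply: (ux [set z | d x z < e]); apply/d_nbhs; exists e.
  have [z [Dz jz zu zu']] := common _ _ _ _ n (u_names n) (u_names (maxn n N))
    (etrans (esym (u_w n n (leqnn n))) (u_w n _ (leq_maxl n N))).
  have -> : y = z by apply: j_inj; rewrite ?inE // jy jz.
  apply: le_trans (dT _ (u (maxn n N).+1) _) _; apply: lerD => //.
  by rewrite dC ltW //; apply: NP; exact: leq_maxr.
Qed.

(** * Points of the shift with a marked origin *)

Section marked_code.
Variables (G : groupType) (e : nat -> G) (i : G -> nat).
Hypothesis eK : cancel e i.

(** Constant outside the codes of pairs, so that each bit of a marked point depends
    on at most one term of s. *)
Definition graph (s : nat -> nat) (k : nat) : bool :=
  if (unpickle k : option (nat * nat)) is Some (n, v) then s n == v else false.

Definition marked (g : G) (s : nat -> nat) : full_shift G :=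
  fun h => inord ((h == g).*2 + graph s (i (g^-1 * h)%g)).

Lemma graph_pickle s n v : graph s (pickle (n, v)) = (s n == v).
Proof. by rewrite /graph pickleK. Qed.

Lemma val_marked g s h :
  marked g s h = ((h == g).*2 + graph s (i (g^-1 * h)%g))%N :> nat.
Proof. by rewrite /marked inordK //; case: eqP; case: graph. Qed.

Lemma marked_mark g s h : (1 < (marked g s h : 'I_4))%N = (h == g).
Proof. by rewrite val_marked; case: eqP; case: graph. Qed.

Lemma marked_graph g s h : odd (marked g s h : 'I_4) = graph s (i (g^-1 * h)%g).
Proof. by rewrite val_marked oddD odd_double oddb. Qed.

Lemma marked_graph_at g s n v :
  odd (marked g s (g * e (pickle (n, v)))%g : 'I_4) = (s n == v).
Proof. by rewrite marked_graph mulKg eK graph_pickle. Qed.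

Lemma marked_inj g s g' s' : marked g s = marked g' s' -> g = g' /\ s = s'.
Proof.
move=> gs; have gg' : g = g'.
  by apply/eqP; rewrite -(marked_mark g' s') -gs marked_mark.
split=> //; subst g'; apply/funext => n.
by apply/esym/eqP; rewrite -(marked_graph_at g) -gs marked_graph_at.
Qed.

Lemma left_shift_marked a g s :
  left_shift a (marked g s) = marked (a * g)%g s.
Proof.
apply/funext => h; rewrite /left_shift /marked invgM mulgA; congr (inord (_ .*2 + _)).
by congr nat_of_bool; rewrite -(can_eq (mulKg a)) mulVKg.
Qed.


Lemma near_coord (Y : set (full_shift G)) (y : Y) (h : G) :
  \forall z \near y, (val z : full_shift G) h = (val y : full_shift G) h.
Proof.
have := @initial_continuous Y (full_shift G) val y.
have pc := @proj_continuous G (fun=> discrete_topology 'I_4) h (val y).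
move=> vc; have := cvg_comp _ _ vc pc.
move/(_ [set a | a = (val y : full_shift G) h]); apply.
by rewrite nbhs_principalE.
Qed.

(** The topology of a space of marked points is that of the pairs (origin,
    sequence). For z close to y, the mark of z at [o y] forces z to have the
    same origin as y, and the bit of z at the element coding (n, s y n) forces
    [s z n = s y n]. Conversely, the letter at h is
    determined by the origin and at most one term of the sequence. *)
Lemma nbhs_marked (Y : set (full_shift G)) (o : Y -> G) (s : Y -> nat -> nat) :
    (forall y, val y = marked (o y) (s y)) ->
  forall y A, nbhs y A <->
    exists N, [set z | o z = o y /\ agree N (s y) (s z)] `<=` A.
Proof.
move=> YE y A; split=> [[_ [[C oC <-] Cy CA]]|[N NA]]; last first.
  have near_o : \forall z \near y, o z = o y.
    near=> z; apply/esym/eqP; rewrite -(marked_mark _ (s z)) -YE.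
    have -> : (val z : full_shift G) (o y) = (val y : full_shift G) (o y).
      by near: z; exact: near_coord.
    by rewrite YE marked_mark.
  have near_s n : \forall z \near y, s y n = s z n.
    near=> z; apply/esym/eqP; rewrite -(marked_graph_at (o z)) -YE.
    have -> : o z = o y by near: z.
    set h := (_ * _)%g.
    have -> : (val z : full_shift G) h = (val y : full_shift G) h.
      by near: z; exact: near_coord.
    by rewrite YE marked_graph_at.
  have near_sN := @near_agree Y y s (s y) N near_s.
  by near=> z; apply: NA; split; near: z.
(* The filter F generated by the prefix neighbourhoods of y converges pointwise
   to y, so that it contains the open set C. *)
pose F := filter_from [set: nat]
  (fun N => [set val z | z in [set z | o z = o y /\ agree N (s y) (s z)]]).
have FF : Filter F.
  apply: filter_from_filter; first by exists 0%N.
  move=> M N _ _; exists (maxn M N) => // _ [z [oz sz] <-].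
  by split; exists z => //; split=> // n nM; apply: sz; rewrite leq_max nM ?orbT.
have Fy : F --> (val y : full_shift G).
  apply/(@pointwise_cvgP (discrete_topology G) (discrete_topology 'I_4)) => h.
  apply/discrete_cvg.
  set p := i ((o y)^-1 * h)%g.
  pose N := if (unpickle p : option (nat * nat)) is Some (n, _) then n.+1 else 0%N.
  exists N => // _ [z [oz sz] <-] /=.
  rewrite !YE /marked oz -/p /graph; congr (inord (_ + nat_of_bool _)).
  move: sz; rewrite /N /graph; case: (unpickle p : option (nat * nat)) => [[n v]|//].
  by move=> ->.
have [N _ NC] : F C by apply: Fy; exact: open_nbhs_nbhs.
by exists N => z zP; apply: CA; apply: NC; exists z.
Unshelve. all: by end_near. Qed.

End marked_code.

Theorem theorem1p4 (R : realType) (G : groupType)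
    (countableG : countable [set: G]) (infiniteG : infinite_set [set: G])
    (X : topologicalType) (polishX : polish R X)
    (act : G -> X -> X) (actX : continuous_action act) :
  exists (Y : set (full_shift G)) (invY : shift_invariant Y),
    polish R Y /\ continuously_factors_onto (restricted_shift invY) act.
Proof.
have [e [i [eK iK]]] : exists (e : nat -> G) (i : G -> nat), cancel e i /\ cancel i e.
  have /card_set_bijP[i bij_i] := eq_card_nat countableG infiniteG.
  have [e iK eK] : bijective i by rewrite -setTT_bijective.
  by exists e, i.
have [names [names_total names_fun names_cts names_closed]] := polish_names polishX.
have [act1 actM act_cts] := actX.
pose Y : set (full_shift G) :=
  [set y | exists g s x, names s x /\ y = marked i g s].
have invY : shift_invariant Y.
  move=> a _ [g [s [x [sx ->]]]]; exists (a * g)%g, s, x; split=> //.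
  exact: left_shift_marked.
have mY (y : Y) : exists gsx : G * (nat -> nat) * X,
    names gsx.1.2 gsx.2 /\ val y = marked i gsx.1.1 gsx.1.2 :> full_shift G.
  by have /set_mem[g [s [x gsx]]] := valP y; exists (g, s, x).
have /choice[d dP] := mY.
pose o y := (d y).1.1; pose s y := (d y).1.2; pose a y := (d y).2.
have YE y : val y = marked i (o y) (s y) by have [] := dP y.
have sa y : names (s y) (a y) by have [] := dP y.
have Y_nbhs := nbhs_marked eK YE.
exists Y, invY; split.
  (* Both the origin and the sequence are recorded in one sequence of naturals. *)
  pose c y n := if n is k.+1 then s y k else i (o y).
  apply: (@polish_of_code R Y c).
  - move=> x y xy; apply: val_inj; rewrite !YE; congr marked.
      exact: (can_inj iK (xy 0%N)).
    by apply/funext => n; exact: (xy n.+1).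
  - move=> y A; rewrite Y_nbhs; split=> -[N NA].
      exists N.+1 => z yz; apply: NA; split; last by move=> n nN; exact: (yz n.+1).
      by apply: (can_inj iK); exact/esym/(yz 0%N).
    exists N => z [oz sz]; apply: NA => -[|n] nN /=; first by rewrite oz.
    by rewrite sz // ltnW.
  - move=> w wP; have [|x wx] := names_closed (w \o succn).
      move=> N; have [y wy] := wP N.+1.
      by exists (s y), (a y); split=> // n nN; exact: (wy n.+1).
    have Yw : Y (marked i (e (w 0%N)) (w \o succn)).
      by exists (e (w 0%N)), (w \o succn), x.
    exists (SigSub (mem_set Yw)).
    have [ow sw] := marked_inj eK (YE (SigSub (mem_set Yw))).
    by move=> [|n] /=; rewrite /c -?ow ?eK -?sw.
exists (fun y => act (o y) (a y)); split.
- move=> y A /= yA.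
  have act_oy : nbhs (a y) [set x | A (act (o y) x)].
    have oa : (o y : discrete_topology G, x) @[x --> a y] -->
        (o y : discrete_topology G, a y).
      exact: cvg_pair (cvg_cst _) cvg_id.
    have := cvg_comp _ _ oa (act_cts (o y : discrete_topology G, a y)).
    by move=> /(_ A yA).
  have [N NA] := names_cts _ _ _ (sa y) act_oy.
  by apply/Y_nbhs; exists N => z [oz sz] /=; rewrite oz; apply: (NA (s z)).
- move=> g y; have := YE (restricted_shift invY g y).
  rewrite [LHS]/= YE left_shift_marked => /(marked_inj eK)[<- sE].
  by rewrite actM; congr (act g (act _ _)); apply: (names_fun (s y)) => //; rewrite sE.
- move=> x; have [t tx] := names_total x.
  have Yt : Y (marked i 1%g t) by exists 1%g, t, x.
  exists (SigSub (mem_set Yt)).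
  have [<- st] := marked_inj eK (YE (SigSub (mem_set Yt))).
  by rewrite act1; apply: (names_fun (s (SigSub (mem_set Yt)))) => //; rewrite -st.
Qed.
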